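(* For every graph $G$ and integer $d\geq1$, the $d$-fold cartesian product $G^d=G\square\cdots\square G$ satisfies $\mathrm{dn}'(G^d)=\mathrm{dn}'(G)$ and $\mathrm{dn}(G^d)=\mathrm{dn}(G)$.
   Context: The cartesian product $G\square H$ has vertex set $V(G)\times V(H)$, where $(v,w)$ is adjacent to $(p,q)$ iff ($v=p$ and $wq\in E(H)$) or ($w=q$ and $vp\in E(G)$). A degenerate drawing of a graph maps vertices to distinct points in the plane and each edge to the open straight-line segment joining its endpoints; a drawing is a degenerate drawing in which no vertex lies in the interior of an edge. The distance-number $\mathrm{dn}(G)$ (resp. degenerate distance-number $\mathrm{dn}'(G)$) is the minimum number of distinct edge-lengths over all drawings (resp. degenerate drawings) of $G$. *)

(* Defs.v *)
From mathcomp Require Import all_boot all_order all_algebra ring.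
From mathcomp Require Import boolp reals.

Set Implicit Arguments.
Unset Strict Implicit.
Unset Printing Implicit Defensive.

Import Order.TTheory GRing.Theory Num.Theory.
Local Open Scope ring_scope.

Record sgraph := SGraph {
  vertex :> finType;
  adj : rel vertex;
  adj_sym : symmetric adj;
  adj_irrefl : irreflexive adj }.

Section CartesianProduct.
Variables G H : sgraph.

Definition cart_adj : rel (G * H)%type := fun x y =>
  ((x.1 == y.1) && adj x.2 y.2) || ((x.2 == y.2) && adj x.1 y.1).

Lemma cart_adj_sym : symmetric cart_adj.
Proof.
move=> x y; rewrite /cart_adj [x.1 == _]eq_sym [x.2 == _]eq_sym.
by rewrite [adj x.2 _]adj_sym [adj x.1 _]adj_sym.
Qed.

Lemma cart_adj_irrefl : irreflexive cart_adj.
Proof. by move=> x; rewrite /cart_adj !adj_irrefl !andbF. Qed.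

Definition cart : sgraph := SGraph cart_adj_sym cart_adj_irrefl.

End CartesianProduct.

(* [cart_pow G d] has [d] factors when [1 <= d]; its value at [d = 0] is
   meaningless (it is [G]). *)
Definition cart_pow (G : sgraph) (d : nat) : sgraph :=
  iter d.-1 (fun H => cart H G) G.

Section Drawings.
Variables (R : realType) (G : sgraph).

(* The norm of ['rV[R]_2] in MathComp-Analysis is the sup norm, hence the
   explicit formula. *)
Definition edist (p q : 'rV[R]_2) : R :=
  Num.sqrt (\sum_i (p ord0 i - q ord0 i) ^+ 2).

Definition in_open_segment (p q x : 'rV[R]_2) : Prop :=
  exists t : R, 0 < t < 1 /\ x = (1 - t) *: p + t *: q.

(* Edges are drawn as straight segments, so the images of the vertices
   determine the drawing. *)
Definition degenerate_drawing (f : G -> 'rV[R]_2) : Prop := injective f.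

Definition drawing (f : G -> 'rV[R]_2) : Prop :=
  degenerate_drawing f /\
  forall u v w : G, adj u v -> ~ in_open_segment (f u) (f v) (f w).

(* Each edge occurs twice, as (u, v) and (v, u); [undup] keeps one copy of each
   length. *)
Definition edge_lengths (f : G -> 'rV[R]_2) : seq R :=
  undup [seq edist (f e.1) (f e.2) | e in [pred e : G * G | adj e.1 e.2]].

Definition num_lengths (f : G -> 'rV[R]_2) : nat := size (edge_lengths f).

Lemma drawing_exists : exists f : G -> 'rV[R]_2, drawing f.
Proof.
pose r (v : G) : R := (enum_rank v)%:R.
exists (fun v => \row_(i < 2) (r v ^+ i.+1)).
have r_inj : injective r.
  by move=> u v /eqP; rewrite eqr_nat => /eqP /val_inj /enum_rank_inj.
split=> [u v /rowP /(_ ord0) | u v w uv [t [/andP[t0 t1] /rowP E]]].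
  by rewrite !mxE !expr1 => /r_inj.
have := E ord0; have := E ord_max; rewrite !mxE /= !expr1 => E2 E1.
have K : t * (1 - t) * (r u - r v) ^+ 2 = 0.
  have -> : t * (1 - t) * (r u - r v) ^+ 2 =
    ((1 - t) * r u ^+ 2 + t * r v ^+ 2) - ((1 - t) * r u + t * r v) ^+ 2.
    by ring.
  by rewrite -E1 -E2 subrr.
move/eqP: K; rewrite !mulf_eq0 gt_eqF //= subr_eq0 gt_eqF //= orbb subr_eq0.
by move=> /eqP /r_inj uv'; rewrite uv' adj_irrefl in uv.
Qed.

Lemma num_lengths_drawing_exists :
  exists k, `[< exists2 f, drawing f & num_lengths f = k >].
Proof.
by have [f Hf] := drawing_exists; exists (num_lengths f); apply/asboolP; exists f.
Qed.

Lemma num_lengths_degenerate_exists :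
  exists k, `[< exists2 f, degenerate_drawing f & num_lengths f = k >].
Proof.
by have [f [Hf _]] := drawing_exists; exists (num_lengths f);
  apply/asboolP; exists f.
Qed.

Definition dn : nat := ex_minn num_lengths_drawing_exists.

Definition degenerate_dn : nat := ex_minn num_lengths_degenerate_exists.

End Drawings.

(* Main.v *)
Require Import Defs.
From mathcomp Require Import all_boot all_order all_algebra.
From mathcomp Require Import boolp reals.
From mathcomp Require Import ring.

Set Implicit Arguments.
Unset Strict Implicit.
Unset Printing Implicit Defensive.

Import Order.TTheory GRing.Theory Num.Theory.
Local Open Scope ring_scope.

(** Fixing the other coordinates embeds [G] in [G^d], so a (degenerate)
    drawing of [G^d] restricts to one of [G] with no new edge-lengths.
    Conversely, if [g] draws [H] and [f] draws [G], then for a rotation [rho]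
    the map [(h, v) |-> g h + rho (f v)] draws every edge of the product as a
    translate of an edge of [g] or of a rotated edge of [f], so it has no new
    edge-lengths either. Each way in which it could fail to be a (degenerate)
    drawing is an equation [p x rho q = a] with [p] and [q] nonzero, which is
    satisfied by at most two rotations; hence all but finitely many rotations
    work. *)

(** * Rotations, cross products and segments in the plane *)

Section Plane.
Variable R : realType.
Implicit Types (p q x : 'rV[R]_2) (c s : R).

Definition cross p q : R := p ord0 ord0 * q ord0 ord_max - p ord0 ord_max * q ord0 ord0.

(** A rotation when [c ^+ 2 + s ^+ 2 = 1]. Cosine and sine are kept as a pair so that they can be
    rational functions of a parameter. *)
Definition rot c s p : 'rV[R]_2 :=
  \row_i (if i == ord0 then c * p ord0 ord0 - s * p ord0 ord_max
          else s * p ord0 ord0 + c * p ord0 ord_max).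

Lemma sum_ord2 (F : 'I_2 -> R) : \sum_i F i = F ord0 + F ord_max.
Proof.
by rewrite !big_ord_recl big_ord0 addr0; congr (_ + F _); apply: val_inj.
Qed.

Lemma edistDl p q x : edist (x + p) (x + q) = edist p q.
Proof.
by rewrite /edist; congr Num.sqrt; apply: eq_bigr => i _; rewrite !mxE; ring.
Qed.

Lemma edistDr p q x : edist (p + x) (q + x) = edist p q.
Proof. by rewrite ![_ + x]addrC edistDl. Qed.

Lemma edist_rot c s p q :
  c ^+ 2 + s ^+ 2 = 1 -> edist (rot c s p) (rot c s q) = edist p q.
Proof.
move=> cs1; rewrite /edist !sum_ord2 !mxE /=; congr Num.sqrt.
rewrite -[RHS]mul1r -cs1; ring.
Qed.

Lemma cross_rot c s p q :
  c ^+ 2 + s ^+ 2 = 1 -> cross (rot c s p) (rot c s q) = cross p q.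
Proof. move=> cs1; rewrite /cross !mxE /= -[RHS]mul1r -cs1; ring. Qed.

Lemma rotB c s p q : rot c s (p - q) = rot c s p - rot c s q.
Proof. by apply/rowP => i; rewrite !mxE; case: ifP => _; ring. Qed.

Lemma crossDl p q x : cross (p + q) x = cross p x + cross q x.
Proof. rewrite /cross !mxE; ring. Qed.

Lemma crossC p q : cross p q = - cross q p.
Proof. rewrite /cross; ring. Qed.

Lemma crossNr p q : cross p (- q) = - cross p q.
Proof. rewrite /cross !mxE; ring. Qed.

Lemma crosspp p : cross p p = 0.
Proof. rewrite /cross; ring. Qed.

(** Unlike betweenness, collinearity is an equation, so a generic rotation can exclude it. *)
Lemma cross_open_segment p q x :
  in_open_segment p q x -> cross (x - p) (q - p) = 0.
Proof. by case=> t [_ ->]; rewrite /cross !mxE; ring. Qed.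

Lemma normsq_eq0 p :
  (p ord0 ord0 ^+ 2 + p ord0 ord_max ^+ 2 == 0) = (p == 0).
Proof.
rewrite paddr_eq0 ?sqr_ge0 // !sqrf_eq0; apply/andP/eqP => [[/eqP p0 /eqP p1]|->].
  apply/rowP => i; rewrite mxE; have [->|i0] := eqVneq i ord0; first by [].
  by rewrite -p1; congr (p _ _); apply: val_inj; case: i i0 => -[|[|]].
by rewrite !mxE.
Qed.

Lemma rotD c s p q : rot c s (p + q) = rot c s p + rot c s q.
Proof. by apply/rowP => i; rewrite !mxE; case: ifP => _; ring. Qed.

Lemma rotZ c s t p : rot c s (t *: p) = t *: rot c s p.
Proof. by apply/rowP => i; rewrite !mxE; case: ifP => _; ring. Qed.

Lemma rotK c s : c ^+ 2 + s ^+ 2 = 1 -> cancel (rot c s) (rot c (- s)).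
Proof.
move=> cs1 p; apply/rowP => i; rewrite !mxE /=.
have [->|] := eqVneq i ord0; first by rewrite -[RHS]mul1r -cs1; ring.
case: i => -[|[|//]] //= i _.
have -> : Ordinal i = ord_max by apply: val_inj.
rewrite -[RHS]mul1r -cs1; ring.
Qed.

Lemma in_open_segment_rot c s p q x :
  in_open_segment p q x ->
  in_open_segment (rot c s p) (rot c s q) (rot c s x).
Proof. by case=> t [t01 ->]; exists t; rewrite rotD !rotZ. Qed.

Lemma in_open_segmentDl y p q x :
  in_open_segment p q x -> in_open_segment (y + p) (y + q) (y + x).
Proof.
case=> t [t01 ->]; exists t; split=> //.
by apply/rowP => i; rewrite !mxE; ring.
Qed.

(** * Choosing a generic rotation *)

Lemma poly_nonroot (P : {poly R}) : P != 0 -> exists t, P.[t] != 0.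
Proof.
move=> P0; apply: contrapT => noroot.
pose rs : seq R := [seq i%:R | i <- iota 0 (size P)].
have : (size rs < size P)%N.
  apply: max_poly_roots => //.
    apply/allP => t _; apply/negPn/negP => Pt; apply: noroot.
    by exists t.
  by rewrite map_inj_uniq ?iota_uniq // => i j /eqP; rewrite eqr_nat => /eqP.
by rewrite size_map size_iota ltnn.
Qed.

(* The rotation through the angle [2 * atan t] turns [cross p (rot _ _ q) = a]
   into a nonzero quadratic equation in [t]. *)
Definition half_angle_poly p q (a : R) : {poly R} :=
  (cross p q)%:P * (1 - 'X^2)
  + (p ord0 ord0 * q ord0 ord0 + p ord0 ord_max * q ord0 ord_max)%:P * ('X *+ 2)
  - a%:P * (1 + 'X^2).

(** If the polynomial vanished, both the cross and the dot product of [p] and [q] would be zero,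
    contrary to Lagrange's identity: their squares add up to the product of the squared norms. *)
Lemma half_angle_poly_neq0 p q a :
  p != 0 -> q != 0 -> half_angle_poly p q a != 0.
Proof.
move=> p0 q0; apply/eqP => P0.
have /eqP : (p ord0 ord0 ^+ 2 + p ord0 ord_max ^+ 2) *
            (q ord0 ord0 ^+ 2 + q ord0 ord_max ^+ 2) = 0.
  set d := p ord0 ord0 * q ord0 ord0 + p ord0 ord_max * q ord0 ord_max.
  have ev t : cross p q * (1 - t ^+ 2) + d * (t *+ 2) - a * (1 + t ^+ 2) = 0.
    by have := congr1 (horner^~ t) P0; rewrite /half_angle_poly !hornerE.
  have d0 : d = 0.
    (* The values at [1] and [-1] differ by [4 d]; below, twice the value at [0] minus the value at
       [1] is [2 (cross p q - d)]. *)
    have : d *+ 4 = 0 by rewrite -[RHS](subrr 0) -{1}(ev 1) -(ev (-1)); ring.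
    by move/eqP; rewrite mulrn_eq0 /= => /eqP.
  have c0 : cross p q = 0.
    have : cross p q *+ 2 = 0.
      have <- : (cross p q * (1 - 0 ^+ 2) + d * (0 *+ 2) - a * (1 + 0 ^+ 2)) *+ 2
        - (cross p q * (1 - 1 ^+ 2) + d * (1 *+ 2) - a * (1 + 1 ^+ 2)) = 0.
        by rewrite !ev mul0rn subrr.
      by rewrite d0; ring.
    by move/eqP; rewrite mulrn_eq0 /= => /eqP.
  have -> : (p ord0 ord0 ^+ 2 + p ord0 ord_max ^+ 2) *
            (q ord0 ord0 ^+ 2 + q ord0 ord_max ^+ 2) = cross p q ^+ 2 + d ^+ 2.
    by rewrite /cross /d; ring.
  by rewrite c0 d0; ring.
by rewrite mulf_eq0 !normsq_eq0 (negPf p0) (negPf q0).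
Qed.

(** A parameter [t] that is not a root of the product of all the quadratics avoids every equation at
    once. *)
Lemma generic_rotation (I : finType) (p q : I -> 'rV[R]_2) (a : I -> R) :
  exists c s, c ^+ 2 + s ^+ 2 = 1 /\
    forall i, p i != 0 -> q i != 0 -> cross (p i) (rot c s (q i)) != a i.
Proof.
pose P := \prod_(i | (p i != 0) && (q i != 0)) half_angle_poly (p i) (q i) (a i).
have /poly_nonroot [t Pt] : P != 0.
  by apply/prodf_neq0 => i /andP[pi0 qi0]; exact: half_angle_poly_neq0.
have t1 : 1 + t ^+ 2 != 0 by rewrite gt_eqF // ltr_pwDl ?sqr_ge0.
exists ((1 - t ^+ 2) / (1 + t ^+ 2)), (t *+ 2 / (1 + t ^+ 2)).
split=> [|i pi0 qi0]; first by field.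
move: Pt; rewrite horner_prod => /prodf_neq0 /(_ i).
rewrite pi0 qi0 => /(_ isT); apply: contraNneq => <-.
rewrite /half_angle_poly !hornerE /cross !mxE /=; apply/eqP.
by field.
Qed.

End Plane.

(** * Drawing a product from drawings of its factors *)

Section Lengths.
Variable R : realType.
Implicit Types G H : sgraph.

Lemma edge_lengthsP G (f : G -> 'rV[R]_2) l :
  reflect (exists u v, adj u v /\ l = edist (f u) (f v)) (l \in edge_lengths f).
Proof.
rewrite mem_undup; apply: (iffP imageP) => [[[u v] uv ->]|[u [v [uv ->]]]].
  by exists u, v.
by exists (u, v).
Qed.

Lemma leq_num_lengths G H (f : G -> 'rV[R]_2) (g : H -> 'rV[R]_2) :
  {subset edge_lengths f <= edge_lengths g} -> (num_lengths f <= num_lengths g)%N.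
Proof. exact/uniq_leq_size/undup_uniq. Qed.

Lemma cart_drawing G H (g : H -> 'rV[R]_2) (f : G -> 'rV[R]_2) :
  injective g -> injective f ->
  exists F : cart H G -> 'rV[R]_2,
    [/\ injective F,
        {subset edge_lengths F <= edge_lengths g ++ edge_lengths f}
      & drawing g -> drawing f -> drawing F].
Proof.
move=> g_inj f_inj.
pose gd (i : H * H) := g i.1 - g i.2; pose fd (i : G * G) := f i.1 - f i.2.
(* An index picks the difference [p] in [H], the difference [q] in [G], and the two differences,
   both in [H] or both in [G], whose cross product gives the forbidden value up to sign. *)
pose I := ((H * H) * (G * G) * ((H * H) * (H * H) + (G * G) * (G * G)))%type.
pose a (i : I) := match i.2 with inl j => cross (gd j.1) (gd j.2)
                               | inr j => - cross (fd j.1) (fd j.2) end.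
have [c [s [cs1 gen]]] :=
  generic_rotation (fun i : I => gd i.1.1) (fun i : I => fd i.1.2) a.
have gneq h h' : h != h' -> g h - g h' != 0 by rewrite subr_eq0 (inj_eq g_inj).
have fneq v v' : v != v' -> f v - f v' != 0 by rewrite subr_eq0 (inj_eq f_inj).
pose F (x : cart H G) := g x.1 + rot c s (f x.2).
have FB x y : F x - F y = (g x.1 - g y.1) + rot c s (f x.2 - f y.2).
  by rewrite rotB /F opprD addrACA.
have F_inj : injective F.
  move=> [h v] [h' v'] Fxy.
  have [hh|hh] := eqVneq h h'.
    by move: Fxy; rewrite /F /= hh => /addrI /(can_inj (rotK cs1)) /f_inj ->.
  have [vv|vv] := eqVneq v v'.
    by move: Fxy; rewrite /F /= vv => /addIr /g_inj ->.
  (* A collision makes [gd (h, h')] parallel to the rotated [fd (v, v')]; the trivial pairs [(h, h)]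
     encode the forbidden value [0]. *)
  have := gen ((h, h'), (v, v'), inl ((h, h), (h, h))) (gneq _ _ hh) (fneq _ _ vv).
  have -> : rot c s (fd (v, v')) = - gd (h, h').
    by apply/eqP; rewrite -addr_eq0 addrC -(FB (h, v) (h', v')) Fxy subrr.
  by rewrite /a /= crossNr !crosspp oppr0 eqxx.
exists F; split=> // [l|[_ gdr] [_ fdr]].
  move/edge_lengthsP => [[h v] [[h' v'] [/= /orP adjE ->]]].
  rewrite mem_cat; apply/orP.
  case: adjE => /andP[/= /eqP E uv]; [right|left]; apply/edge_lengthsP.
    by exists v, v'; rewrite /F /= E edistDl edist_rot.
  by exists h, h'; rewrite /F /= E edistDr.
split=> // -[h v] [h' v'] [h'' v''] /= /orP[] /andP[/= /eqP E uv] seg.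
  subst h'; have [E|hh] := eqVneq h'' h.
    (* Vertex and edge lie in one copy of [G]: translating and rotating back gives a forbidden
       incidence in [f]. *)
    subst h''; apply: (fdr v v' v'') => //.
    have /(in_open_segment_rot c (- s)) := in_open_segmentDl (- g h) seg.
    by rewrite /F /= !addKr !(rotK cs1).
  have vv : v' != v by apply: contraTneq uv => ->; rewrite adj_irrefl.
  (* The rotated edge direction is [q]. The [G]-part of the offset is rotated too, so its cross
     product with [q] does not depend on the rotation and moves into [a]. *)
  have := gen ((h'', h), (v', v), inr ((v'', v), (v', v))) (gneq _ _ hh) (fneq _ _ vv).
  have := cross_open_segment seg.
  rewrite !FB /= subrr add0r crossDl (cross_rot _ _ cs1) => /eqP.
  by rewrite addr_eq0 => ->.
subst v'; have [E|vv] := eqVneq v'' v.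
  subst v''; apply: (gdr h h' h'') => //.
  have := in_open_segmentDl (- rot c s (f v)) seg.
  by rewrite /F /= ![_ + rot _ _ _]addrC !addKr.
have hh : h' != h by apply: contraTneq uv => ->; rewrite adj_irrefl.
(* Now the edge direction is [p], and [q] is the [G]-part of the offset. *)
have := gen ((h', h), (v'', v), inl ((h'', h), (h', h))) (gneq _ _ hh) (fneq _ _ vv).
have := cross_open_segment seg; rewrite !FB /= subrr.
have -> : rot c s 0 = 0 :> 'rV[R]_2.
  by rewrite -[X in rot _ _ X](subrr (f v)) rotB subrr.
by rewrite addr0 crossDl => /eqP; rewrite addr_eq0 -crossC => /eqP <-; rewrite eqxx.
Qed.

(** Every factor is drawn by the same [f], up to rotation, so the lengths stay among those of
    [f]. *)
Lemma cart_pow_drawing G d (f : G -> 'rV[R]_2) :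
  injective f ->
  exists F : cart_pow G d -> 'rV[R]_2,
    [/\ injective F, {subset edge_lengths F <= edge_lengths f}
      & drawing f -> drawing F].
Proof.
move=> f_inj; rewrite /cart_pow; elim: d.-1 => [|n [g [g_inj gf g_dr]]] /=.
  by exists f; split.
have [F [F_inj Fgf F_dr]] := cart_drawing g_inj f_inj.
exists F; split=> // [l /Fgf|f_dr]; last exact: F_dr (g_dr f_dr) f_dr.
by rewrite mem_cat => /orP[/gf|].
Qed.

(** * Restricting a drawing of a power to one copy of the last factor *)

Lemma drawing_cart_section G H (h : H) (F : cart H G -> 'rV[R]_2) :
  drawing F -> drawing (fun v => F (h, v)).
Proof.
move=> [F_inj F_dr]; split=> [v v' /F_inj [] //|u v w uv].
by apply: F_dr; rewrite /= /cart_adj /= eqxx uv.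
Qed.

Lemma edge_lengths_cart_section G H (h : H) (F : cart H G -> 'rV[R]_2) :
  {subset edge_lengths (fun v => F (h, v)) <= edge_lengths F}.
Proof.
move=> l /edge_lengthsP [u [v [uv ->]]]; apply/edge_lengthsP.
by exists (h, u), (h, v); rewrite /= /cart_adj /= eqxx uv.
Qed.

Lemma cart_pow_vertex G d : G -> cart_pow G d.
Proof. by rewrite /cart_pow => v; elim: d.-1 => [|n h] //=; exact: (h, v). Qed.

Lemma cart_pow_section G d (F : cart_pow G d -> 'rV[R]_2) :
  injective F ->
  exists f : G -> 'rV[R]_2,
    [/\ injective f, (num_lengths f <= num_lengths F)%N & drawing F -> drawing f].
Proof.
case: d F => [|[|n]] F F_inj; [by exists F | by exists F |].
have [v _|noG] := pickP (predT : pred G).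
  pose h := cart_pow_vertex n.+1 v.
  exists (fun v => F (h, v)); split; last exact: drawing_cart_section.
    by move=> u w /F_inj [].
  exact/leq_num_lengths/edge_lengths_cart_section.
(* An empty [G] offers no copy to restrict to, but any drawing of it has no edge-lengths. *)
have [f f_dr] := drawing_exists R G; exists f; split=> //; first exact: f_dr.1.
by apply: leq_num_lengths => l /edge_lengthsP [v]; have := noG v.
Qed.

(** * Comparing the minima *)

Lemma degenerate_dn_le G (f : G -> 'rV[R]_2) :
  degenerate_drawing f -> (degenerate_dn R G <= num_lengths f)%N.
Proof.
rewrite /degenerate_dn => f_inj; case: ex_minnP => m _; apply.
by apply/asboolP; exists f.
Qed.

Lemma degenerate_dn_attained G :
  exists2 f : G -> 'rV[R]_2, degenerate_drawing f & num_lengths f = degenerate_dn R G.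
Proof. by rewrite /degenerate_dn; case: ex_minnP => m /asboolP. Qed.

Lemma dn_le G (f : G -> 'rV[R]_2) : drawing f -> (dn R G <= num_lengths f)%N.
Proof.
rewrite /dn => f_dr; case: ex_minnP => m _; apply.
by apply/asboolP; exists f.
Qed.

Lemma dn_attained G :
  exists2 f : G -> 'rV[R]_2, drawing f & num_lengths f = dn R G.
Proof. by rewrite /dn; case: ex_minnP => m /asboolP. Qed.

End Lengths.

Theorem theorem25 (R : realType) (G : sgraph) (d : nat) (hd : (1 <= d)%N) :
  degenerate_dn R (cart_pow G d) = degenerate_dn R G /\
  dn R (cart_pow G d) = dn R G.
Proof.
split; apply/eqP; rewrite eqn_leq; apply/andP; split.
- have [f f_inj <-] := degenerate_dn_attained R G.
  have [F [F_inj Ff _]] := cart_pow_drawing d f_inj.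
  exact: leq_trans (degenerate_dn_le F_inj) (leq_num_lengths Ff).
- have [F F_inj <-] := degenerate_dn_attained R (cart_pow G d).
  have [f [f_inj fF _]] := cart_pow_section F_inj.
  exact: leq_trans (degenerate_dn_le f_inj) fF.
- have [f f_dr <-] := dn_attained R G.
  have [F [_ Ff F_dr]] := cart_pow_drawing d f_dr.1.
  exact: leq_trans (dn_le (F_dr f_dr)) (leq_num_lengths Ff).
- have [F F_dr <-] := dn_attained R (cart_pow G d).
  have [f [_ fF f_dr]] := cart_pow_section F_dr.1.
  exact: leq_trans (dn_le (f_dr F_dr)) fF.
Qed.
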